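(* Let $P$ be a finite poset and let $t\geq 2$ be a fixed integer. Then, as $n\to\infty$, either $\mathrm{sat}^{\star}([t]^n,P)=\Omega(\sqrt{n})$ or $\mathrm{sat}^{\star}([t]^n,P)=O(1)$.
   Context: For positive integers $n,t$, $[n]=\{1,\dots,n\}$ and the hypergrid $[t]^n$ is the set of functions $f:[n]\to[t]$, partially ordered by $f\leq g$ iff $f(i)\leq g(i)$ for all $i\in[n]$. An induced copy of a poset $P$ in a family $\mathcal{F}\subseteq[t]^n$ is an injective map $\phi:P\to\mathcal{F}$ such that $\phi(x)\leq\phi(y)$ iff $x\leq_P y$. A family $\mathcal{F}\subseteq[t]^n$ is induced $P$-free if it contains no induced copy of $P$; it is induced $P$-saturated if it is induced $P$-free and for every $f\in[t]^n\setminus\mathcal{F}$ the family $\mathcal{F}\cup\{f\}$ contains an induced copy of $P$. Whenever $P$ embeds as an induced subposet of $[t]^n$, $\mathrm{sat}^{\star}([t]^n,P)$ denotes the minimum size of an induced $P$-saturated family in $[t]^n$. Asymptotic notation is as $n\to\infty$ with $t$ and $P$ fixed. *)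

(* Defs.v *)
From Stdlib Require Import Reals.
From HB Require Import structures.
From mathcomp Require Import all_boot all_order.

Set Implicit Arguments. Unset Strict Implicit. Unset Printing Implicit Defensive.

(* The hypergrid [t]^n : functions [n] -> [t], encoded as {ffun 'I_n -> 'I_t}
   (value k : 'I_t stands for k+1 in [t]). *)
Definition grid (t n : nat) := {ffun 'I_n -> 'I_t}.

Definition gle (t n : nat) (f g : grid t n) : bool := [forall i, f i <= g i].

Section Sat.
Variables (d : Order.disp_t) (P : finPOrderType d) (t n : nat).

Definition has_induced_copy (F : {set grid t n}) : bool :=
  [exists phi : {ffun P -> grid t n},
     [&& injectiveb phi,
         [forall x, phi x \in F] &
         [forall x, forall y, gle (phi x) (phi y) == (x <= y)%O]]].

Definition induced_free (F : {set grid t n}) : bool := ~~ has_induced_copy F.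

Definition induced_saturated (F : {set grid t n}) : bool :=
  induced_free F &&
  [forall f : grid t n, (f \notin F) ==> has_induced_copy (f |: F)].

Definition embeds : bool := has_induced_copy [set: grid t n].

(* sat*([t]^n, P): minimum size of an induced P-saturated family.
   (Only meaningful when a saturated family exists; the default value
   #|[t]^n|.+1 is returned otherwise.) *)
Definition satstar : nat :=
  \big[minn/#|[set: grid t n]|.+1]_(F : {set grid t n} | induced_saturated F) #|F|.
End Sat.

Definition BigOmega_sqrt (f : nat -> nat) : Prop :=
  exists c : R, Rlt 0 c /\ exists N : nat, forall n : nat, (N <= n)%N ->
    Rle (Rmult c (sqrt (INR n))) (INR (f n)).

Definition BigO_one (f : nat -> nat) : Prop :=
  exists C N : nat, forall n : nat, (N <= n)%N -> (f n <= C)%N.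

(* Main.v *)
Require Import Defs.
From Stdlib Require Import Reals Classical.
From HB Require Import structures.
From mathcomp Require Import all_boot all_order.
From mathcomp Require Import zify.

Set Implicit Arguments. Unset Strict Implicit. Unset Printing Implicit Defensive.

(** Call a coordinate [i] witnessed by a saturated family [F] if some [f, g] in
    [F] satisfy [f <= g] off [i] but [f i > g i]. A pair witnesses at most one
    coordinate, so [n <= #|F| ^ 2] if every coordinate is witnessed. If [i] is
    not witnessed, the order on [F] is determined off [i], and the values at
    [i] can be changed: merging the largest non-maximal value at [i] into the
    maximal one keeps [F] saturated, so we may assume that only the two extreme
    values occur at [i]. Then [i] can be repeated arbitrarily often, again
    keeping [F] saturated, which bounds the saturation number for all larger
    dimensions. *)

(** * Comparing grid points away from one coordinate *)

Section Grid.
Variables (t n : nat).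
Implicit Types (f g h : grid t n) (i : 'I_n) (c : 'I_t) (F : {set grid t n}).

Lemma gleP f g : reflect (forall i, f i <= g i) (gle f g).
Proof. exact: forallP. Qed.

Lemma grid_ltn f i : f i < t.
Proof. exact: ltn_ord. Qed.

Lemma gle_refl f : gle f f.
Proof. exact/gleP. Qed.

Lemma gle_anti f g : gle f g -> gle g f -> f = g.
Proof.
move=> /gleP fg /gleP gf; apply/ffunP=> i; apply: val_inj.
by apply/eqP; rewrite eqn_leq fg gf.
Qed.

Definition le_off i f g : bool := [forall j, (j != i) ==> (f j <= g j)].

Lemma le_offP i f g :
  reflect (forall j, j != i -> f j <= g j) (le_off i f g).
Proof. exact: 'forall_implyP. Qed.

Lemma le_off_trans i g f h : le_off i f g -> le_off i g h -> le_off i f h.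
Proof.
move=> /le_offP fg /le_offP gh; apply/le_offP=> j ji.
exact: leq_trans (fg j ji) (gh j ji).
Qed.

Lemma gle_off i f g : gle f g = le_off i f g && (f i <= g i).
Proof.
apply/gleP/andP=> [fg|[/le_offP fg fgi] j]; first by split=> //; apply/le_offP.
by case: (eqVneq j i) => [->|/fg].
Qed.

Definition upd i f c : grid t n := [ffun j => if j == i then c else f j].

Lemma upd_at i f c : upd i f c i = c.
Proof. by rewrite ffunE eqxx. Qed.

Lemma upd_off i f c j : j != i -> upd i f c j = f j.
Proof. by rewrite ffunE => /negbTE->. Qed.

Lemma le_off_updl i f g c : le_off i (upd i f c) g = le_off i f g.
Proof.
by apply/le_offP/le_offP=> fg j ji; move: (fg j ji); rewrite upd_off.
Qed.

Lemma le_off_updr i f g c : le_off i f (upd i g c) = le_off i f g.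
Proof.
by apply/le_offP/le_offP=> fg j ji; move: (fg j ji); rewrite upd_off.
Qed.

Lemma le_off_refl i f : le_off i f f.
Proof. exact/le_offP. Qed.

Lemma gle_updl i f g c : gle (upd i f c) g = le_off i f g && (c <= g i).
Proof. by rewrite (gle_off i) le_off_updl upd_at. Qed.

Lemma gle_updr i f g c : gle f (upd i g c) = le_off i f g && (f i <= c).
Proof. by rewrite (gle_off i) le_off_updr upd_at. Qed.

Definition unwitnessed i F :=
  forall f g, f \in F -> g \in F -> le_off i f g -> f i <= g i.

Lemma witnessed_card F :
  (forall i, ~ unwitnessed i F) -> n <= #|F| * #|F|.
Proof.
move=> wit.
have wit_ex i : exists p : grid t n * grid t n,
    (p \in setX F F) && (le_off i p.1 p.2 && (p.2 i < p.1 i)).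
  apply: NNPP => noP; apply: (wit i) => f g fF gF fg; rewrite leqNgt.
  apply/negP=> lt; apply: noP; exists (f, g).
  by rewrite in_setX fF gF /= fg.
pose w i := xchoose (wit_ex i).
(* If one pair served both [i] and [j], its comparison off [j] would contradict the strict reverse
   inequality at [i]. *)
have w_inj : injective w.
  move=> i j wij; apply/eqP/negPn/negP=> ij.
  have /and3P[_ _ lt_i] := xchooseP (wit_ex i).
  have /and3P[_ /le_offP/(_ i ij)] := xchooseP (wit_ex j).
  by move: wij lt_i; rewrite /w => ->; case: ltngtP.
rewrite -cardsX -{1}(card_ord n) -(card_codom w_inj).
apply/subset_leq_card/subsetP=> _ /codomP[i ->].
by case/andP: (xchooseP (wit_ex i)).
Qed.

End Grid.

(** * Carrying saturated families from one grid to another *)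

Section Saturation.
Variables (d : Order.disp_t) (P : finPOrderType d) (t : nat).

Lemma has_induced_copyP n (F : {set grid t n}) :
  reflect (exists phi : P -> grid t n, (forall x, phi x \in F) /\
             (forall x y, gle (phi x) (phi y) = (x <= y)%O))
          (has_induced_copy P F).
Proof.
apply: (iffP existsP) => [[phi /and3P[_ /forallP phiF /forallP phi_le]]|].
  by exists phi; split=> // x y; move/forallP: (phi_le x) => /(_ y)/eqP.
case=> phi [phiF phi_le]; exists (finfun phi); apply/and3P; split.
- apply/injectiveP=> x y; rewrite !ffunE => eq_phi; apply: Order.POrderTheory.le_anti.
  by rewrite -!phi_le eq_phi gle_refl.
- by apply/forallP=> x; rewrite ffunE.
- by apply/forallP=> x; apply/forallP=> y; rewrite !ffunE phi_le.
Qed.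

Lemma has_induced_copy_map n m (A : {set grid t n}) (B : {set grid t m})
    (r : grid t n -> grid t m) :
  {in A, forall f, r f \in B} ->
  {in A &, forall f g, gle (r f) (r g) = gle f g} ->
  has_induced_copy P A -> has_induced_copy P B.
Proof.
move=> rB r_le /has_induced_copyP[phi [phiA phi_le]].
apply/has_induced_copyP; exists (r \o phi); split=> [x|x y] /=; first exact: rB.
by rewrite r_le.
Qed.

(** The point [g'] stands in for [g]: a copy of [P] in [g' |: F] is carried into [g |: e @: F] by
    sending [g'] to [g] and applying [e] on [F]. Freeness pulls back along [e], which embeds [F]. *)
Lemma saturated_transfer n m (F : {set grid t n}) (e : grid t n -> grid t m) :
  {in F &, forall f g, gle (e f) (e g) = gle f g} ->
  (forall g : grid t m, g \notin e @: F -> exists2 g', g' \notin F &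
     {in F, forall h, gle g (e h) = gle g' h /\ gle (e h) g = gle h g'}) ->
  induced_saturated P F -> induced_saturated P (e @: F).
Proof.
move=> e_le repl /andP[freeF /forallP satF].
apply/andP; split.
  apply: contra freeF => /has_induced_copyP[phi [phiF phi_le]].
  have pre x : exists h, (h \in F) && (phi x == e h).
    by case/imsetP: (phiF x) => h hF ->; exists h; rewrite hF eqxx.
  apply/has_induced_copyP; exists (fun x => xchoose (pre x)).
  split=> [x|x y]; first by case/andP: (xchooseP (pre x)).
  have /andP[xF /eqP phix] := xchooseP (pre x).
  have /andP[yF /eqP phiy] := xchooseP (pre y).
  by rewrite -e_le // -phix -phiy phi_le.
apply/forallP=> g; apply/implyP=> gNF.
have [g' g'NF g'P] := repl g gNF.
move/implyP: (satF g') => /(_ g'NF).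
apply: (has_induced_copy_map (r := fun f => if f == g' then g else e f)).
  move=> f; case: eqP => [_ _|fg']; first exact: setU11.
  case/setU1P=> [/fg'//|fF]; apply: setU1r; exact: imset_f.
have ne f : f \in F -> (f == g') = false.
  by move=> fF; apply/eqP=> fg'; rewrite -fg' fF in g'NF.
move=> f h /setU1P[->|fF] /setU1P[->|hF]; rewrite ?eqxx ?(ne f) ?(ne h) //.
- by rewrite !gle_refl.
- by case: (g'P h hF).
- by case: (g'P f fF).
- exact: e_le.
Qed.


Lemma satstar_le n (F : {set grid t n}) :
  induced_saturated P F -> satstar P t n <= #|F|.
Proof.
move=> satF; rewrite /satstar; have := mem_index_enum F.
elim: (index_enum _) => // G r IH; rewrite inE big_cons => /predU1P[<-|/IH le].
  by rewrite satF geq_minl.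
by case: ifP => // _; rewrite geq_min le orbT.
Qed.

(** [minn] returns one of its arguments, so [satstar] is the default value or the size of a
    saturated family. *)
Lemma satstar_ind n (K : nat -> Prop) :
  K #|[set: grid t n]|.+1 ->
  (forall F : {set grid t n}, induced_saturated P F -> K #|F|) ->
  K (satstar P t n).
Proof.
move=> K0 KF; apply: big_ind => // a b Ka Kb.
by rewrite /minn; case: ifP.
Qed.

End Saturation.

(** * Changing values at an unwitnessed coordinate, and repeating it *)

Section Unwitnessed.
Variables (d : Order.disp_t) (P : finPOrderType d) (s n : nat) (i : 'I_n).
Implicit Types (F : {set grid s.+1 n}).

Local Ltac iflia := repeat case: ifP => ?; lia.

Lemma merge_value F (k : nat) :
  0 < k < s -> induced_saturated P F -> unwitnessed i F ->
  {in F, forall f : grid s.+1 n, f i <= k \/ f i = ord_max} ->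
  exists F', [/\ induced_saturated P F', unwitnessed i F', #|F'| <= #|F| &
    {in F', forall f : grid s.+1 n, f i < k \/ f i = ord_max}].
Proof.
case/andP=> k_gt0 k_lt satF unw valF.
pose e (f : grid s.+1 n) := upd i f (if k <= f i then ord_max else f i).
have ei f : e f i = (if k <= f i then s else f i) :> nat.
  by rewrite upd_at; case: ifP.
have geE f g : gle (e f) g = le_off i f g && ((if k <= f i then s else f i) <= g i).
  by rewrite gle_updl; case: ifP.
have leE f g : gle f (e g) = le_off i f g && (f i <= (if k <= g i then s else g i)).
  by rewrite gle_updr; case: ifP.
have kP : k < s.+1 by lia.
have k1P : k.-1 < s.+1 by lia.
have e_upd (g : grid s.+1 n) (c : 'I_s.+1) : (g i : nat) = (if k <= c then s else c) -> e (upd i g c) = g.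
  move=> gi; apply/ffunP=> j; rewrite /e !ffunE.
  case: (eqVneq j i) => [->|//]; apply: val_inj; rewrite /= eqxx gi.
  by case: ifP.
exists (e @: F); split; last 1 first.
- move=> _ /imsetP[f fF ->]; rewrite /e upd_at.
  by case: (leqP k (f i)) => [_|lt]; [right|left].
- apply: saturated_transfer satF => [f g fF gF|g gNF].
    rewrite geE (gle_off i) ei le_off_updr.
    case le_fg: (le_off i f g) => //=.
    by have := unw f g fF gF le_fg; have := grid_ltn f i; iflia.
  (* The stand-in for [g] differs from it at most at [i], so only points of [F] comparable to [g]
     off [i] constrain its value [c]. *)
  suff [c [cF upP downP]] : exists c : 'I_s.+1, [/\ upd i g c \notin F,
      {in F, forall h : grid s.+1 n, le_off i g h ->
         (g i <= (if k <= h i then s else h i)) = (c <= h i)} &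
      {in F, forall h : grid s.+1 n, le_off i h g ->
         ((if k <= h i then s else h i) <= g i) = (h i <= c)}].
    exists (upd i g c) => // h hF; rewrite leE geE gle_updl gle_updr.
    split; [case gh: (le_off i g h) => //=|case hg: (le_off i h g) => //=].
      exact: upP.
    exact: downP.
  have notin (c : 'I_s.+1) : (g i : nat) = (if k <= c then s else c) -> upd i g c \notin F.
    by move=> gi; apply: contra gNF => uF; rewrite -(e_upd g c gi); apply: imset_f.
  have gi_le := grid_ltn g i.
  case: (ltnP (g i) k) => [gi_lt|gi_ge].
    exists (g i); split=> [|h hF _|h hF _]; first by apply: notin; iflia.
      by have := grid_ltn h i; iflia.
    by iflia.
  (* If [k <= g i < s], then [c] must separate the values below [k] from the others. When some [h1]
     below [g] off [i] has value [k], every [h] above [g] off [i] has value at least [k], and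
     [k - 1] works. *)
  case: (ltnP (g i) s) => [gi_lts|gi_ges].
    case: (boolP [exists h : grid s.+1 n in F, le_off i h g && (h i == k :> nat)]).
      case/existsP=> h1 /and3P[h1F h1g /eqP h1i].
      exists (Ordinal k1P); split=> [|h hF gh|h hF hg] /=.
      + apply/negP=> uF; have := unw _ _ h1F uF.
        by rewrite le_off_updr upd_at /= h1i => /(_ h1g); iflia.
      + have := unw _ _ h1F hF (le_off_trans h1g gh).
        by rewrite h1i; iflia.
      + by iflia.
    (* Without such an [h1], the value [k] works; if the updated point were in [F], it would be such
       an [h1] itself. *)
    rewrite negb_exists => /forallP no.
    exists (Ordinal kP); split=> [|h hF gh|h hF hg] /=.
    + apply/negP=> uF; have := no (upd i g (Ordinal kP)).
      by rewrite uF le_off_updl le_off_refl upd_at eqxx.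
    + by iflia.
    + by have := no h; rewrite hF hg /=; iflia.
  (* Here [g i] is maximal, so [k] and the maximum are the candidates. A point of value [k] above
     [g] off [i] caps at [k] all values of points below [g] off [i], so [k] works. *)
  case: (boolP [exists h : grid s.+1 n in F, le_off i g h && (h i == k :> nat)]).
    case/existsP=> h1 /and3P[h1F gh1 /eqP h1i].
    exists (Ordinal kP); split=> [|h hF gh|h hF hg] /=.
    + by apply: notin => /=; iflia.
    + by iflia.
    + have := unw _ _ hF h1F (le_off_trans hg gh1).
      by rewrite h1i; have := grid_ltn h i; iflia.
  (* Otherwise, above [g] off [i], a value at least [k] is maximal by [valF]. *)
  rewrite negb_exists => /forallP no.
  exists ord_max; split=> [|h hF gh|h hF hg] /=.
  + by apply: notin => /=; iflia.
  + have := no h; rewrite hF gh /= => hk.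
    by case: (valF h hF) => [|->] /=; iflia.
  + by have := grid_ltn h i; iflia.
- move=> _ _ /imsetP[f fF ->] /imsetP[g gF ->].
  rewrite le_off_updl le_off_updr !ei => /(unw f g fF gF).
  by have := grid_ltn f i; iflia.
- exact: leq_imset_card.
Qed.

(** Merging is repeated for [k] from [s - 1] down to 1. *)
Lemma extreme_values F :
  induced_saturated P F -> unwitnessed i F ->
  exists F', [/\ induced_saturated P F', unwitnessed i F', #|F'| <= #|F| &
    {in F', forall f : grid s.+1 n, f i = 0 :> nat \/ f i = ord_max}].
Proof.
move=> satF unw.
suff H j : j < s -> exists F', [/\ induced_saturated P F', unwitnessed i F',
    #|F'| <= #|F| &
    {in F', forall f : grid s.+1 n, f i < s - j \/ f i = ord_max}].
  case: (posnP s) => [s0|s_gt0].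
    exists F; split=> // f _; left; have := grid_ltn f i; lia.
  case: (H s.-1) => [|F' [satF' unw' leF' val]]; first by lia.
  exists F'; split=> // f /val [lt|->]; [left; lia|by right].
elim: j => [|j IH] lt_js.
  exists F; split=> // f _; rewrite subn0.
  case: (ltnP (f i) s) => [|ge]; [by left|right; apply: val_inj => /=].
  by apply/eqP; rewrite eqn_leq ge andbT -ltnS ltn_ord.
case: IH => [|F1 [sat1 unw1 le1 val1]]; first by lia.
have kP : 0 < s - j.+1 < s by lia.
case: (merge_value kP sat1 unw1) => [f /val1[lt|->]|F' [sat' unw' le' val']].
- left; lia.
- by right.
- by exists F'; split=> //; apply: leq_trans le' le1.
Qed.

(** A point that is not constant on the copies of [i] compares with the family as if its value at
    [i] lay strictly between the two extremes; as in merging, one of the extremes can replace it. *)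
Lemma clone_coordinate F m :
  0 < s -> n <= m -> induced_saturated P F -> unwitnessed i F ->
  {in F, forall f : grid s.+1 n, f i = 0 :> nat \/ f i = ord_max} ->
  satstar P s.+1 m <= #|F|.
Proof.
move=> s_gt0 le_nm satF unw valF.
pose w (j : 'I_n) : 'I_m := widen_ord le_nm j.
(* The default value of [insubd] makes every index from [n] on a copy of [i]. *)
pose r (j : 'I_m) : 'I_n := insubd i (val j).
have rw j : r (w j) = j by rewrite /r /w valKd.
have rP j : r j != i -> j = w (r j).
  rewrite /r => rj; apply: val_inj; rewrite /= val_insubd.
  by case: ifP => // ge; rewrite /insubd insubF ?eqxx in rj.
pose e (f : grid s.+1 n) : grid s.+1 m := [ffun j => f (r j)].
pose g0 (g : grid s.+1 m) : grid s.+1 n := [ffun j => g (w j)].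
have leE g h : gle g (e h) = le_off i (g0 g) h && [forall (j | r j == i), g j <= h i].
  apply/gleP/andP=> [gh|[/le_offP gh /forall_inP ghi] j].
    split; first by apply/le_offP=> j _; have := gh (w j); rewrite !ffunE rw.
    by apply/forall_inP=> j /eqP rj; have := gh j; rewrite ffunE rj.
  rewrite ffunE; case: (eqVneq (r j) i) => [rj|rj].
    by rewrite rj; apply: ghi; rewrite rj.
  by have := gh _ rj; rewrite ffunE -rP.
have geE g h : gle (e h) g = le_off i h (g0 g) && [forall (j | r j == i), h i <= g j].
  apply/gleP/andP=> [gh|[/le_offP gh /forall_inP ghi] j].
    split; first by apply/le_offP=> j _; have := gh (w j); rewrite !ffunE rw.
    by apply/forall_inP=> j /eqP rj; have := gh j; rewrite ffunE rj.
  rewrite ffunE; case: (eqVneq (r j) i) => [rj|rj].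
    by rewrite rj; apply: ghi; rewrite rj.
  by have := gh _ rj; rewrite ffunE -rP.
apply: leq_trans (leq_imset_card e F); apply: satstar_le.
apply: saturated_transfer satF => [f g fF gF|g gNF].
  apply/gleP/gleP=> fg j; last by rewrite !ffunE.
  by have := fg (w j); rewrite !ffunE rw.
suff [c [cF upP downP]] : exists c : 'I_s.+1, [/\ upd i (g0 g) c \notin F,
    {in F, forall h : grid s.+1 n, le_off i (g0 g) h ->
       [forall (j | r j == i), g j <= h i] = (c <= h i)} &
    {in F, forall h : grid s.+1 n, le_off i h (g0 g) ->
       [forall (j | r j == i), h i <= g j] = (h i <= c)}].
  exists (upd i (g0 g) c) => // h hF; rewrite leE geE gle_updl gle_updr.
  split; [case gh: (le_off i (g0 g) h) => //=|case hg: (le_off i h (g0 g)) => //=].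
    exact: upP.
  exact: downP.
(* If [g] is constant on the copies, it is the image under [e] of its restriction, so the common
   value serves as [c]. *)
case: (boolP [exists c : 'I_s.+1, forall (j | r j == i), g j == c]).
  case/existsP=> c /forall_inP gc; exists c.
  have rwi : r (w i) == i by rewrite rw.
  split=> [|h hF _|h hF _].
  - apply: contra gNF => uF; suff -> : g = e (upd i (g0 g) c) by apply: imset_f.
    apply/ffunP=> j; rewrite !ffunE; case: eqP => [/eqP/gc/eqP//|/eqP rj].
    by rewrite -rP.
  - apply/forall_inP/idP=> [/(_ _ rwi)|le j rj]; first by rewrite (eqP (gc _ rwi)).
    by rewrite (eqP (gc _ rj)).
  - apply/forall_inP/idP=> [/(_ _ rwi)|le j rj]; first by rewrite (eqP (gc _ rwi)).
    by rewrite (eqP (gc _ rj)).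
rewrite negb_exists => /forallP nonconst.
have [/forall_inPn[j0 /= rj0 g_n0] /forall_inPn[j1 /= rj1 g_ns]] :=
  (nonconst ord0, nonconst ord_max).
have upE h : h \in F -> [forall (j | r j == i), g j <= h i] = (s <= h i).
  move=> /valF hi; apply/forall_inP/idP=> [/(_ _ rj0)|le j _].
    by case: hi => -> //=; move: g_n0; rewrite -val_eqE /=; lia.
  by have := grid_ltn g j; lia.
have downE h : h \in F -> [forall (j | r j == i), h i <= g j] = (h i <= 0).
  move=> /valF hi; apply/forall_inP/idP=> [/(_ _ rj1)|le j _]; last by lia.
  case: hi => -> //=; move: g_ns; rewrite -val_eqE /=.
  by have := grid_ltn g j1; lia.
(* A maximal value below [g] off [i] forces maximal values above it, so 0 works. Otherwise all
   values below are 0, and the maximum works. *)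
case: (boolP [exists h : grid s.+1 n in F, le_off i h (g0 g) && (h i == ord_max)]).
  case/existsP=> h1 /and3P[h1F h1g /eqP h1i].
  exists ord0; split=> [|h hF gh|h hF hg].
  - apply/negP=> uF; have := unw _ _ h1F uF.
    by rewrite le_off_updr upd_at h1i /= => /(_ h1g); lia.
  - rewrite upE //; have := unw _ _ h1F hF (le_off_trans h1g gh).
    by rewrite h1i /=; lia.
  - by rewrite downE.
rewrite negb_exists => /forallP no.
exists ord_max; split=> [|h hF gh|h hF hg].
- apply/negP=> uF; have := no (upd i (g0 g) ord_max).
  by rewrite uF le_off_updl le_off_refl upd_at eqxx.
- by rewrite upE.
- rewrite downE //; have := no h; rewrite hF hg /=.
  by case: (valF h hF) => ->; rewrite ?eqxx //=; lia.
Qed.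

End Unwitnessed.

Theorem mainTheorem1 (d : Order.disp_t) (P : finPOrderType d) (t : nat) :
  2 <= t ->
  BigOmega_sqrt (fun n => satstar P t n) \/ BigO_one (fun n => satstar P t n).
Proof.
case: t => // s s_gt0.
(* The split ranges over all dimensions at once: a single unwitnessed coordinate in one dimension
   bounds all larger ones. *)
case: (classic (exists n (i : 'I_n) (F : {set grid s.+1 n}),
         induced_saturated P F /\ unwitnessed i F)).
  case=> n [i [F [satF unw]]]; right.
  have [F' [satF' unw' _ val]] := extreme_values satF unw.
  by exists #|F'|, n => m le_nm; apply: clone_coordinate val.
move=> no_unw; left; exists (IZR 1); split; first exact: Rlt_0_1.
exists 0 => n _; rewrite Rmult_1_l.
have le_sq : n <= satstar P s.+1 n * satstar P s.+1 n.
  apply: (@satstar_ind _ P s.+1 n (fun v => n <= v * v)).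
    (* The default value of [satstar] is also large enough, since [n < s.+1 ^ n]. *)
    rewrite cardsT card_ffun !card_ord.
    have := ltn_expl n (s_gt0 : 1 < s.+1); nia.
  move=> F satF; apply: witnessed_card => i unw.
  by apply: no_unw; exists n, i, F.
rewrite -(sqrt_square (INR (satstar P s.+1 n))); last exact: pos_INR.
rewrite -mult_INR; apply: sqrt_le_1_alt; apply: le_INR.
exact/leP.
Qed.
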